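(* Let $K/k$ be a separable field extension of degree $5$ and $\widetilde{K}/k$ its Galois closure. If $\operatorname{Gal}(\widetilde{K}/k)$ has order $20$ and $F$ is a field with $K\subsetneq F\subsetneq\widetilde{K}$, then the degree $10$ extension $F/k$ is Hopf Galois but not almost classically Galois. Moreover, $F/k$ has at least two different Hopf Galois structures.
   Context: A finite extension of fields $L/k$ is called Hopf Galois if there exists a finite cocommutative $k$-Hopf algebra $H$ such that $L$ is an $H$-module algebra and the $k$-linear map $j: L\otimes_k H\to \operatorname{End}_k(L)$, $j(s\otimes h)(t)=s(ht)$ for $h\in H$, $s,t\in L$, is bijective. A Hopf Galois structure on $L/k$ is such an $H$ together with its action on $L$, considered up to isomorphism of $k$-Hopf algebras compatible with the actions on $L$. Let $L/k$ be a finite separable extension with Galois closure $\widetilde{L}/k$, $\Gamma=\operatorname{Gal}(\widetilde{L}/k)$, $\Gamma'=\operatorname{Gal}(\widetilde{L}/L)$, and let $\lambda:\Gamma\to\operatorname{Sym}(\Gamma/\Gamma')$ be the left translation action on left cosets. $L/k$ is called almost classically Galois if there is a regular (i.e. sharply transitive) subgroup $N$ of $\operatorname{Sym}(\Gamma/\Gamma')$ which is normalized by $\lambda(\Gamma)$ and contained in $\lambda(\Gamma)$; equivalently, $\Gamma'$ has a normal complement in $\Gamma$. *)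

(* Defs.v *)
From HB Require Import structures.
From mathcomp Require Import all_boot all_order all_algebra all_fingroup.
From mathcomp Require Import all_solvable all_field.

Set Implicit Arguments.
Unset Strict Implicit.
Unset Printing Implicit Defensive.

Import GRing.Theory.
Local Open Scope ring_scope.

(* Tensor product of finite-dimensional vector spaces, in coordinates: the    *)
(* matrix t stands for \sum_(i, j) t i j *: (e_i (x) e'_j), where e and e'    *)
(* are the canonical bases of V and W.                                        *)
Definition tensor (k : fieldType) (V W : vectType k) : vectType k :=
  'M[k]_(\dim {:V}, \dim {:W}).

Definition ptensor (k : fieldType) (V W : vectType k) (v : V) (w : W) :
    tensor V W :=
  \matrix_(i, j) (coord (vbasis {:V}) i v * coord (vbasis {:W}) j w).

(* The linear map on V (x) W induced by f. It is meant for bilinear f, and    *)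
(* is then characterised by tlift f (v (x) w) = f v w, see tliftE below;      *)
(* with Delta h = \sum h_1 (x) h_2, Sweedler's \sum f h_1 h_2 is              *)
(* tlift f (Delta h).                                                         *)
Definition tlift (k : fieldType) (V W U : vectType k) (f : V -> W -> U)
    (t : tensor V W) : U :=
  \sum_i \sum_j
    (t : 'M_(_, _)) i j *: f (vbasis {:V})`_i (vbasis {:W})`_j.

Lemma tlift_is_linear (k : fieldType) (V W U : vectType k) (f : V -> W -> U) :
  linear (tlift f).
Proof.
move=> a s t; rewrite /tlift scaler_sumr -big_split; apply: eq_bigr => i _.
rewrite scaler_sumr -big_split; apply: eq_bigr => j _.
by rewrite !mxE scalerDl scalerA.
Qed.

Lemma tliftE (k : fieldType) (V W U : vectType k) (f : V -> W -> U) :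
    (forall w, linear (f^~ w)) -> (forall v, linear (f v)) ->
  forall v w, tlift f (ptensor v w) = f v w.
Proof.
move=> fl fr v w.
have f0l w' : f 0 w' = 0.
  by have := fl w' (-1) 0 0; rewrite scaler0 addr0 scaleN1r addNr.
have f0r v' : f v' 0 = 0.
  by have := fr v' (-1) 0 0; rewrite scaler0 addr0 scaleN1r addNr.
have fsl w' n (c : 'I_n -> k) (x : 'I_n -> V) :
    f (\sum_i c i *: x i) w' = \sum_i c i *: f (x i) w'.
  elim: n c x => [|n IH] c x; first by rewrite !big_ord0 f0l.
  by rewrite !big_ord_recl [LHS]fl IH.
have fsr v' n (c : 'I_n -> k) (x : 'I_n -> W) :
    f v' (\sum_i c i *: x i) = \sum_i c i *: f v' (x i).
  elim: n c x => [|n IH] c x; first by rewrite !big_ord0 f0r.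
  by rewrite !big_ord_recl [LHS]fr IH.
rewrite {2}(coord_vbasis (memvf v)) fsl; apply: eq_bigr => i _.
rewrite {2}(coord_vbasis (memvf w)) fsr scaler_sumr; apply: eq_bigr => j _.
by rewrite mxE scalerA.
Qed.

Lemma tensor_ext (k : fieldType) (V W U : vectType k)
    (f g : {linear tensor V W -> U}) :
  (forall v w, f (ptensor v w) = g (ptensor v w)) -> f =1 g.
Proof.
move=> fg t; rewrite [t](@matrix_sum_delta _ (\dim {:V}) (\dim {:W})).
rewrite !linear_sum; apply: eq_bigr => i _; rewrite !linear_sum.
apply: eq_bigr => j _; rewrite !linearZ; congr (_ *: _).
suff -> : delta_mx i j = ptensor (vbasis {:V})`_i (vbasis {:W})`_j by [].
apply/matrixP => a b; rewrite !mxE !coord_free ?(basis_free (vbasisP _)) //.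
by rewrite [a == i]eq_sym [b == j]eq_sym; do 2?case: eqP => _ /=; rewrite ?mulr1 ?mulr0.
Qed.

Record cocomHopf (k : fieldType) := CocomHopf {
  hopf_alg :> falgType k;
  hcomul : 'Hom(hopf_alg, tensor hopf_alg hopf_alg);
  hcounit : 'Hom(hopf_alg, k^o);
  hantipode : 'End(hopf_alg);
  hcomulA : forall h,
    tlift (fun a b => tlift (fun a1 a2 => ptensor a1 (ptensor a2 b)) (hcomul a))
      (hcomul h)
    = tlift (fun a b => ptensor a (hcomul b)) (hcomul h);
  hcounitl : forall h,
    tlift (fun a b => (hcounit a : k) *: b) (hcomul h) = h;
  hcounitr : forall h,
    tlift (fun a b => (hcounit b : k) *: a) (hcomul h) = h;
  hcomul1 : hcomul 1 = ptensor 1 1;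
  hcomulM : forall g h, hcomul (g * h) =
    tlift (fun g1 g2 =>
      tlift (fun h1 h2 => ptensor (g1 * h1) (g2 * h2)) (hcomul h)) (hcomul g);
  hcounit1 : hcounit 1 = 1;
  hcounitM : forall g h, hcounit (g * h) = hcounit g * hcounit h;
  hantipodel : forall h,
    tlift (fun a b => hantipode a * b) (hcomul h) = (hcounit h : k) *: 1;
  hantipoder : forall h,
    tlift (fun a b => a * hantipode b) (hcomul h) = (hcounit h : k) *: 1;
  hcomulC : forall h, tlift (fun a b => ptensor b a) (hcomul h) = hcomul h
}.

Definition module_algebra (k : fieldType) (H : cocomHopf k)
    (L : fieldExtType k) (act : 'Hom(H, 'End(L))) : Prop :=
  [/\ act 1 = \1%VF,
      forall g h, act (g * h) = (act g \o act h)%VF,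
      forall h, act h 1 = (hcounit H h : k) *: 1
    & forall h s t, act h (s * t) =
        tlift (fun h1 h2 => act h1 s * act h2 t) (hcomul H h)].

(* j : L (x) H -> End_k(L), j (s (x) h) = (t |-> s * h t) *)
Definition hopf_galois_map (k : fieldType) (H : cocomHopf k)
    (L : fieldExtType k) (act : 'Hom(H, 'End(L))) : tensor L H -> 'End(L) :=
  tlift (fun s h => (amull s \o act h)%VF).

Record hopfGaloisStructure (k : fieldType) (L : fieldExtType k) :=
  HopfGaloisStructure {
    hgs_hopf : cocomHopf k;
    hgs_act : 'Hom(hgs_hopf, 'End(L));
    hgs_module_algebra : module_algebra hgs_act;
    hgs_bijective : bijective (hopf_galois_map hgs_act)
  }.

Definition hopf_galois (k : fieldType) (L : fieldExtType k) : Prop :=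
  exists _ : hopfGaloisStructure L, True.

Definition hopf_iso (k : fieldType) (H1 H2 : cocomHopf k)
    (phi : 'Hom(H1, H2)) : Prop :=
  [/\ bijective phi,
      phi 1 = 1 /\ (forall g h, phi (g * h) = phi g * phi h),
      forall h, hcomul H2 (phi h) =
        tlift (fun a b => ptensor (phi a) (phi b)) (hcomul H1 h),
      forall h, hcounit H2 (phi h) = hcounit H1 h
    & forall h, hantipode H2 (phi h) = phi (hantipode H1 h)].

Definition hgs_iso (k : fieldType) (L : fieldExtType k)
    (S1 S2 : hopfGaloisStructure L) : Prop :=
  exists phi : 'Hom(hgs_hopf S1, hgs_hopf S2),
    hopf_iso phi /\ forall h, hgs_act S2 (phi h) = hgs_act S1 h.

(* M plays the role of a normal extension of k large enough to contain all    *)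
(* the fields under consideration.                                            *)
Definition galois_closure (k : fieldType) (M : splittingFieldType k)
    (L E : {subfield M}) : Prop :=
  [/\ (L <= E)%VS, galois 1 E
    & forall E' : {subfield M}, (L <= E')%VS -> galois 1 E' -> (E <= E')%VS].

(* In gal_of E the product x * y is "x, then y", the opposite of composition  *)
(* of functions (galM). Hence the left coset g \o Gal(E / L) for composition  *)
(* is here 'Gal(E / L) :* g, and left translation is right multiplication.    *)
Definition gal_cosets (k : fieldType) (M : splittingFieldType k)
    (L E : {subfield M}) : {set {set gal_of E}} :=
  rcosets 'Gal(E / L) 'Gal(E / 1).

(* The permutations of a finite set X are represented by the permutations of  *)
(* the ambient type with support in X (perm_on X).                            *)
Definition gal_transl (k : fieldType) (M : splittingFieldType k)
    (L E : {subfield M}) (g : gal_of E) : {perm {set gal_of E}} :=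
  restr_perm (gal_cosets L E) (actperm 'Rs g).

Lemma gal_translE (k : fieldType) (M : splittingFieldType k)
    (L E : {subfield M}) (g : gal_of E) (C : {set gal_of E}) :
  g \in 'Gal(E / 1)%g -> C \in gal_cosets L E ->
  gal_transl L g C = (C :* g)%g.
Proof.
move=> gG CX.
have sX (h : gal_of E) D : h \in 'Gal(E / 1)%g -> D \in gal_cosets L E ->
    (D :* h)%g \in gal_cosets L E.
  move=> hG /rcosetsP[x xG ->]; rewrite -rcosetM.
  by apply/rcosetsP; exists (x * h)%g; rewrite ?groupM.
rewrite restr_permE //; first by rewrite actpermE /= rcosetE.
apply/astabsP => D; rewrite /= apermE actpermE /= rcosetE.
apply/idP/idP => DX; last exact: sX.
by rewrite -[D](rcosetK g); apply: sX; rewrite ?groupV.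
Qed.

Definition gal_transl_image (k : fieldType) (M : splittingFieldType k)
    (L E : {subfield M}) : {set {perm {set gal_of E}}} :=
  [set gal_transl L g | g in 'Gal(E / 1)%g].

Definition regular_on (T : finType) (X : {set T}) (N : {group {perm T}}) :
    Prop :=
  {in N, forall p, perm_on X p} /\
  (forall x y, x \in X -> y \in X -> exists! n, n \in N /\ n x = y).

Definition almost_classically_galois (k : fieldType) (M : splittingFieldType k)
    (L : {subfield M}) : Prop :=
  exists E : {subfield M}, galois_closure L E /\
  exists N : {group {perm {set gal_of E}}},
    [/\ regular_on (gal_cosets L E) N,
        gal_transl_image L E \subset 'N(N)%g
      & N \subset gal_transl_image L E].

(* Main.v *)
(* A Hopf Galois structure on F/k comes from a finite group N on which Gamma  *)
(* = Gal(Kt/k) acts by automorphisms, together with a surjective 1-cocycle    *)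
(* tau : Gamma -> N whose kernel is Gal(Kt/F). Then N is identified with the  *)
(* set of embeddings of F in Kt, and H = Kt[N]^Gamma acts on F by (\sum_x c_x *)
(* x) a = \sum_x c_x x(a). By independence of characters, a k-basis of H is a *)
(* Kt-basis of Kt[N], so an identity in H (x) H may be checked in Kt[N x N],  *)
(* and a Gamma-invariant element of Kt[N x N] lies in H (x) H.                *)
(*   Here Gamma = P ><| C with P of order 5 and C = Gal(Kt/K) cyclic of order *)
(* 4 acting faithfully on P, and Gal(Kt/F) is the group of squares of C. Let  *)
(* pi : Gamma -> C be the projection and let N = P ><| Gal(Kt/F), which is    *)
(* dihedral of order 10. Then g |-> pi(g) g is a cocycle for the conjugation  *)
(* action on N, and g |-> (pi(g) g)^-1 is one for the action by conjugation   *)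
(* by pi(g)^-1. In the second structure P acts trivially on N; if both Hopf   *)
(* algebras had the same image in End(F), P would centralize N.               *)
(*   If F/k were almost classically Galois, the regular subgroup of           *)
(* translations would contain one moving the base coset to that of a          *)
(* generator c of C. Its square is the translation by c^2 and fixes the base  *)
(* coset, hence is trivial. As c^2 generates Gal(Kt/F), this group would be   *)
(* normal in Gamma, contradicting that Kt is the Galois closure of K.         *)

Require Import Defs.
From HB Require Import structures.
From mathcomp Require Import all_boot all_order all_algebra all_fingroup.
From mathcomp Require Import all_solvable all_field.

Set Implicit Arguments.
Unset Strict Implicit.
Unset Printing Implicit Defensive.

Import GRing.Theory.
Local Open Scope ring_scope.

(** The positive half is Galois descent. For a [holomorph_cocycle], the equivariant functions from N
    to E form a k-form of the group algebra E[N]. By independence of characters they separate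
    functionals on E[N] ([hcoef_separate]), and a k-basis of them stays independent over E
    ([hbasis_independent]). So [hbasis_inverse] expresses group elements in such a basis, the Hopf
    structure of E[N] descends, and its axioms are tested on coefficients ([tlift_comul],
    [coef2_inj], [coef3_inj]). Independence of the embeddings of F then gives [action_bijective].
    The structures from [conj_cocycle] and [opp_cocycle] differ: by [conj_opp_image] an isomorphism
    would make P centralize Gal(Kt/F), against the faithfulness in [order20_structure]. For the
    negative half, [almost_classical_core] would make Gal(Kt/F) normal, which [galois_closure_core]
    excludes. *)

(** * Linear preliminaries on tensors and base scalars *)

HB.instance Definition _ (k : fieldType) (V W U : vectType k) (f : V -> W -> U) :=
  GRing.isLinear.Build k (tensor V W) U _ (tlift f) (tlift_is_linear f).

Lemma tlift_ptensor (k : fieldType) (V W : vectType k) (M : falgType k)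
    (p : {linear V -> M}) (r : {linear W -> M}) v w :
  tlift (fun a b => p a * r b) (ptensor v w) = p v * r w.
Proof.
apply: (tliftE (f := fun a b => p a * r b)) => {v w} [w|v] a x y.
  by rewrite linearP mulrDl scalerAl.
by rewrite linearP mulrDr scalerAr.
Qed.

Lemma dim_lfun (k : fieldType) (V W : vectType k) :
  dim 'Hom(V, W) = (dim V * dim W)%N.
Proof. by []. Qed.

Lemma dim_tensor (k : fieldType) (V W : vectType k) :
  dim (tensor V W) = (dim V * dim W)%N.
Proof. by rewrite [LHS]dim_matrix !dimvf. Qed.

Section BaseScalar.

Variables (k : fieldType) (M : fieldExtType k).

(** A k-linear retraction of M onto k, total so that [comul_fun] and [counit_fun] are linear maps
    before their sums are known to lie in k. Only its values on the line of 1 matter. *)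
Definition scalar_of (a : M) : k := coord [tuple (1 : M)] 0 a.

Lemma scalar_of_is_linear : linear (scalar_of : M -> k^o).
Proof. by move=> a u v; rewrite /scalar_of linearP. Qed.

HB.instance Definition _ :=
  GRing.isLinear.Build k M k^o _ scalar_of scalar_of_is_linear.

Lemma scalar_ofA c : scalar_of c%:A = c.
Proof.
rewrite /scalar_of linearZ /=.
rewrite (coord_free (X := [tuple (1 : M)]) 0 0) ?eqxx ?mulr1 //.
by rewrite seq1_free oner_neq0.
Qed.

Lemma scalar_ofK a : a \in 1%VS -> (scalar_of a)%:A = a.
Proof. by case/vlineP=> c ->; rewrite scalar_ofA. Qed.

End BaseScalar.

(* A homomorphism from Gamma to the holomorph of nT, in cocycle form. The     *)
(* action is on the right because g * h is g followed by h in gal_of E.       *)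
Record holomorph_cocycle (k : fieldType) (M : splittingFieldType k)
    (E F : {subfield M}) (nT : finGroupType) := HolomorphCocycle {
  hc_act : nT -> gal_of E -> nT;
  hc_cocycle : gal_of E -> nT;
  hc_section : nT -> gal_of E;
  hc_actM : forall g, {morph hc_act^~ g : x y / (x * y)%g};
  hc_act1 : forall x, hc_act x 1%g = x;
  hc_actA : forall x g h, hc_act x (g * h)%g = hc_act (hc_act x g) h;
  hc_cocycleM : forall g h,
    hc_cocycle (g * h)%g = (hc_cocycle h * hc_act (hc_cocycle g) h)%g;
  hc_cocycle1 : forall g, hc_cocycle g = 1%g <-> g \in 'Gal(E / F)%g;
  hc_sectionK : cancel hc_section hc_cocycle
}.

(** * Equivariant functions and Galois descent *)

Section EquivariantFunctions.

Variables (k : fieldType) (M : splittingFieldType k) (E F : {subfield M}).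
Variables (nT : finGroupType) (D : holomorph_cocycle E F nT).

Local Notation act := (hc_act D).
Local Notation tau := (hc_cocycle D).
Local Notation sec := (hc_section D).

Lemma hc_actK g : cancel (act^~ g) (act^~ g^-1%g).
Proof. by move=> x; rewrite -hc_actA mulgV hc_act1. Qed.

Lemma hc_actVK g : cancel (act^~ g^-1%g) (act^~ g).
Proof. by move=> x; rewrite -hc_actA mulVg hc_act1. Qed.

Lemma hc_act_inj g : injective (act^~ g).
Proof. exact: can_inj (hc_actK g). Qed.

Lemma hc_act_eq g x y : (act x g == act y g) = (x == y).
Proof. exact: (inj_eq (@hc_act_inj g)). Qed.

Lemma hc_act1g g : act 1%g g = 1%g.
Proof. by apply: (mulgI (act 1%g g)); rewrite -hc_actM !mulg1. Qed.

Lemma hc_actV g x : act x^-1%g g = (act x g)^-1%g.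
Proof. by apply: (mulgI (act x g)); rewrite -hc_actM !mulgV hc_act1g. Qed.

Lemma hc_act_reindex (V : nmodType) g (f : nT -> V) :
  \sum_x f (act x g) = \sum_x f x.
Proof. by rewrite [RHS](reindex_inj (@hc_act_inj g)). Qed.

Definition coef_at (x : nT) : 'Hom({ffun nT -> M}, M) :=
  linfun (fun c : {ffun nT -> M} => c x).

Lemma coef_atE x (c : {ffun nT -> M}) : coef_at x c = c x.
Proof.
have lin : linear (fun c : {ffun nT -> M} => c x).
  by move=> a u v; rewrite !ffunE.
pose f := GRing.isLinear.Build _ _ _ _ _ lin.
pose g : {linear {ffun nT -> M} -> M} :=
  HB.pack (fun c : {ffun nT -> M} => c x) f.
exact: (lfunE g).
Qed.

(** The fixed points of the semilinear action on E[N], which moves coefficients by g and group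
    elements by [act^~ g]. *)
Definition equivariant : {vspace {ffun nT -> M}} :=
  (\bigcap_x (coef_at x @^-1: E) :&:
   \bigcap_g \bigcap_x
      lker (gal_repr g \o coef_at x - coef_at (act x g))%VF)%VS.

Lemma equivariantP (c : {ffun nT -> M}) :
  reflect ((forall x, c x \in E) /\
           forall (g : gal_of E) x, g (c x) = c (act x g))
    (c \in equivariant).
Proof.
rewrite memv_cap; apply: (iffP andP) => [[cE cg]|[cE cg]]; split.
- move=> x; move/subv_bigcapP: cE => /(_ x isT).
  by rewrite -memvE -memv_preim coef_atE.
- move=> g x; move/subv_bigcapP: cg => /(_ g isT)/subv_bigcapP/(_ x isT).
  rewrite -memvE memv_ker !lfun_simp !coef_atE subr_eq0.
  by move/eqP.
- by apply/subv_bigcapP => x _; rewrite -memvE -memv_preim coef_atE.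
apply/subv_bigcapP => g _; apply/subv_bigcapP => x _.
by rewrite -memvE memv_ker !lfun_simp !coef_atE subr_eq0 cg.
Qed.

Definition descended : Type := subvs_of equivariant.

HB.instance Definition _ := Vector.on descended.

Definition hcoef (x : nT) (c : descended) : M := (vsval c : {ffun nT -> M}) x.

Lemma hcoef_is_linear x : linear (hcoef x).
Proof. by move=> a u v; rewrite /hcoef linearP !ffunE. Qed.

HB.instance Definition _ x :=
  GRing.isLinear.Build k descended M _ (hcoef x) (hcoef_is_linear x).

Lemma hcoef_inj (a b : descended) : (forall x, hcoef x a = hcoef x b) -> a = b.
Proof. by move=> ab; apply/val_inj/ffunP => x; apply: ab. Qed.

Lemma hcoefE x c : hcoef x c \in E.
Proof. by have /equivariantP[+ _] := subvsP c; apply. Qed.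

Lemma gal_hcoef (g : gal_of E) x c : g (hcoef x c) = hcoef (act x g) c.
Proof. by have /equivariantP[_ +] := subvsP c; apply. Qed.

(** The projection returns [f] itself only when [f] is equivariant, which [hbuildE] asks for. *)
Definition hbuild (f : nT -> M) : descended := vsproj equivariant [ffun x => f x].

Lemma hbuildE (f : nT -> M) :
    (forall x, f x \in E) -> (forall (g : gal_of E) x, g (f x) = f (act x g)) ->
  forall x, hcoef x (hbuild f) = f x.
Proof.
move=> fE fg x; rewrite /hcoef vsprojK ?ffunE //.
by apply/equivariantP; split=> [y|g y]; rewrite !ffunE.
Qed.

(** * The convolution algebra *)

Definition hone : descended := hbuild (fun x => (x == 1%g)%:R).

Lemma hcoef_one x : hcoef x hone = (x == 1%g)%:R.
Proof.
apply: hbuildE => {x} [x|g x]; first exact: rpred_nat.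
by rewrite rmorph_nat -(hc_act_eq g x) hc_act1g.
Qed.

Definition hmul (a b : descended) : descended :=
  hbuild (fun z => \sum_x \sum_y hcoef x a * hcoef y b * ((x * y)%g == z)%:R).

Lemma hcoef_mul_def a b z :
  hcoef z (hmul a b)
  = \sum_x \sum_y hcoef x a * hcoef y b * ((x * y)%g == z)%:R.
Proof.
apply: (hbuildE (f := fun z => \sum_x \sum_y _)) => {z} [z|g z].
  by do 2![apply: rpred_sum => ? _]; rewrite !rpredM ?hcoefE ?rpred_nat.
rewrite -[RHS](hc_act_reindex g) rmorph_sum; apply: eq_bigr => x _.
rewrite -[RHS](hc_act_reindex g) rmorph_sum; apply: eq_bigr => y _.
by rewrite !rmorphM /= !gal_hcoef rmorph_nat -hc_actM hc_act_eq.
Qed.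

Lemma hsum_delta (x : nT) (f : nT -> M) : \sum_y f y * (x == y)%:R = f x.
Proof.
rewrite (bigD1 x) //= eqxx mulr1 big1 ?addr0 // => y /negPf yx.
by rewrite eq_sym yx mulr0.
Qed.

(* Pairing with an arbitrary test function turns the convolution product into *)
(* a double sum, from which associativity is immediate.                       *)
Lemma hpair_mul a b (f : nT -> M) :
  \sum_z hcoef z (hmul a b) * f z =
  \sum_x \sum_y hcoef x a * (hcoef y b * f (x * y)%g).
Proof.
under eq_bigr => z _ do rewrite hcoef_mul_def mulr_suml.
rewrite exchange_big; apply: eq_bigr => x _ /=.
under eq_bigr => z _ do rewrite mulr_suml.
rewrite exchange_big; apply: eq_bigr => y _ /=.
under eq_bigr => z _ do rewrite mulrAC.
by rewrite (hsum_delta (x * y)%g (fun z => _ * _ * f z)) mulrA.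
Qed.

Lemma hcoef_pair a z : hcoef z a = \sum_x hcoef x a * (x == z)%:R.
Proof. by under eq_bigr => x _ do rewrite eq_sym; rewrite hsum_delta. Qed.

Lemma hmulA : associative hmul.
Proof.
(* The coefficient at [z] is the pairing with the indicator function of [z]. *)
move=> a b c; apply: hcoef_inj => z; rewrite ![hcoef z _]hcoef_pair !hpair_mul.
under eq_bigr => x _ do rewrite -mulr_sumr hpair_mul mulr_sumr.
under [RHS]eq_bigr => x _ do rewrite -mulr_sumr.
rewrite [RHS](hpair_mul a b (fun x => \sum_y hcoef y c * (x * y == z)%g%:R)).
apply: eq_bigr => x _.
apply: eq_bigr => y _; rewrite !mulr_sumr; apply: eq_bigr => w _.
by rewrite mulgA.
Qed.

Lemma hmul1l : left_id hone hmul.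
Proof.
move=> a; apply: hcoef_inj => z; rewrite hcoef_pair hpair_mul (bigD1 1%g) //=.
rewrite hcoef_one eqxx [X in _ + X]big1 => [|x /negPf x1]; last first.
  by rewrite hcoef_one x1 -mulr_sumr mul0r.
rewrite addr0 [RHS]hcoef_pair; apply: eq_bigr => x _.
by rewrite mul1r mul1g.
Qed.

Lemma hmul1r : right_id hone hmul.
Proof.
move=> a; apply: hcoef_inj => z; rewrite hcoef_pair hpair_mul [RHS]hcoef_pair.
apply: eq_bigr => x _; rewrite (bigD1 1%g) //= hcoef_one eqxx mul1r mulg1.
by rewrite big1 ?addr0 // => y /negPf y1; rewrite hcoef_one y1 mul0r mulr0.
Qed.

Lemma hmulDl : left_distributive hmul +%R.
Proof.
move=> a b c; apply: hcoef_inj => z; rewrite linearD /= !hcoef_mul_def -big_split.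
apply: eq_bigr => x _; rewrite -big_split; apply: eq_bigr => y _ /=.
by rewrite linearD !mulrDl.
Qed.

Lemma hmulDr : right_distributive hmul +%R.
Proof.
move=> a b c; apply: hcoef_inj => z; rewrite linearD /= !hcoef_mul_def -big_split.
apply: eq_bigr => x _; rewrite -big_split; apply: eq_bigr => y _ /=.
by rewrite linearD mulrDr mulrDl.
Qed.

Lemma hone_neq0 : hone != 0.
Proof.
apply: contra_eq_neq (hcoef_one 1%g) => ->.
by rewrite linear0 eqxx eq_sym oner_neq0.
Qed.

HB.instance Definition _ := GRing.Zmodule_isNzRing.Build descended
  hmulA hmul1l hmul1r hmulDl hmulDr hone_neq0.

Lemma hscaleAl (a : k) (u v : descended) : a *: (u * v) = (a *: u) * v.
Proof.
apply: hcoef_inj => z; rewrite linearZ /= !hcoef_mul_def scaler_sumr.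
apply: eq_bigr => x _; rewrite scaler_sumr; apply: eq_bigr => y _ /=.
by rewrite linearZ /= !scalerAl.
Qed.

Lemma hscaleAr (a : k) (u v : descended) : a *: (u * v) = u * (a *: v).
Proof.
apply: hcoef_inj => z; rewrite linearZ /= !hcoef_mul_def scaler_sumr.
apply: eq_bigr => x _; rewrite scaler_sumr; apply: eq_bigr => y _ /=.
by rewrite linearZ /= -scalerAr !scalerAl.
Qed.

HB.instance Definition _ := GRing.Lmodule_isLalgebra.Build k descended hscaleAl.
HB.instance Definition _ := GRing.Lalgebra_isAlgebra.Build k descended hscaleAr.
HB.instance Definition _ := Algebra_isFalgebra.Build k descended.

Lemma hcoef1 x : hcoef x 1 = (x == 1%g)%:R.
Proof. exact: hcoef_one. Qed.

Lemma hpairM a b (f : nT -> M) :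
  \sum_z hcoef z (a * b) * f z =
  \sum_x \sum_y hcoef x a * (hcoef y b * f (x * y)%g).
Proof. exact: hpair_mul. Qed.

(** * Galois descent *)

Hypothesis galE : galois 1 E.

Lemma gal_in1 (g : gal_of E) : g \in 'Gal(E / 1)%g.
Proof.
rewrite gal_kHom ?sub1v //; apply/kAHomP => a /vlineP[c ->].
by rewrite linearZ /= rmorph1.
Qed.

Lemma fixed_in1 a :
  a \in E -> (forall g : gal_of E, g a = a) -> a \in 1%VS.
Proof.
move=> aE ag; have /galois_fixedField <- := galE.
by apply/fixedFieldP => // g _; apply: ag.
Qed.

Lemma gal_independence (d : gal_of E -> M) :
  (forall a, a \in E -> \sum_g d g * g a = 0) -> forall g, d g = 0.
Proof.
by move=> d0 g; apply: (@gal_independent _ _ E predT) => // a /d0.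
Qed.

Lemma gal_trace_in1 a : a \in E -> \sum_(g : gal_of E) g a \in 1%VS.
Proof.
move=> aE; apply: fixed_in1 => [|h].
  by apply: rpred_sum => g _; apply: memv_gal.
rewrite rmorph_sum [RHS](reindex_inj (mulIg h)) /=.
by apply: eq_bigr => g _; rewrite galM.
Qed.

(** For each [a] in E the orbit sum of [g a] placed at [act x g] is equivariant. Pairing [d] with it
    gives a linear relation between the characters g with coefficients [d (act x g)]. *)
Lemma hcoef_separate (d : nT -> M) :
  (forall h : descended, \sum_x d x * hcoef x h = 0) -> forall x, d x = 0.
Proof.
move=> d0 x; rewrite -(hc_act1 D x).
apply: (gal_independence (d := fun g => d (act x g))) => a aE.
pose f y : M := \sum_(g : gal_of E) g a * (act x g == y)%:R.
rewrite -[RHS](d0 (hbuild f)).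
have fE y : hcoef y (hbuild f) = f y.
  apply: hbuildE => {y} [y|g y].
    by apply: rpred_sum => g _; rewrite rpredM ?rpred_nat ?memv_gal.
  rewrite [RHS](reindex_inj (mulIg g)) rmorph_sum; apply: eq_bigr => h _ /=.
  by rewrite rmorphM rmorph_nat galM // hc_actA hc_act_eq.
under [RHS]eq_bigr => y _ do rewrite fE mulr_sumr.
rewrite exchange_big; apply: eq_bigr => g _ /=.
under eq_bigr => y _ do rewrite mulrA.
by rewrite (hsum_delta _ (fun y => d y * g a)).
Qed.

Local Notation e i := (vbasis {:descended})`_i.

(** Multiply an E-relation by [a] and take traces: since the basis vectors are equivariant, this is
    a k-relation whose coefficients are the traces of [a * d i]. These vanish for all [a], and
    independence of characters gives [d i = 0]. *)
Lemma hbasis_independent (d : 'I_(\dim {:descended}) -> M) :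
    (forall i, d i \in E) -> (forall x, \sum_i d i * hcoef x (e i) = 0) ->
  forall i, d i = 0.
Proof.
move=> dE d0 i.
suff tr0 a : a \in E -> \sum_(g : gal_of E) g (a * d i) = 0.
  rewrite -(gal_id E (d i)).
  apply: (gal_independence (d := fun g : gal_of E => g (d i))) => a aE.
  rewrite -[RHS](tr0 a aE).
  apply: eq_bigr => g _.
  by rewrite rmorphM mulrC.
move=> aE.
have /fin_all_exists[c cE] j :
    exists c : k, \sum_(g : gal_of E) g (a * d j) = c%:A.
  by apply/vlineP/gal_trace_in1/rpredM.
rewrite cE; suff -> : c i = 0 by rewrite scale0r.
have /freeP bfree := basis_free (vbasisP {:descended}).
apply: bfree.
apply: hcoef_inj => x; rewrite linear0 linear_sum.
transitivity (\sum_(g : gal_of E)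
    g (a * \sum_i d i * hcoef (act x g^-1%g) (e i))); last first.
  by apply: big1 => g _; rewrite d0 mulr0 rmorph0.
under [RHS]eq_bigr => g _ do rewrite mulr_sumr rmorph_sum.
rewrite exchange_big; apply: eq_bigr => j _ /=.
rewrite linearZ /= -[hcoef x _]mul1r scalerAl -cE mulr_suml.
by apply: eq_bigr => g _; rewrite mulrA [RHS]rmorphM /= gal_hcoef hc_actVK.
Qed.

(** The matrix of coefficients of a k-basis has independent rows by [hbasis_independent] and
    independent columns by [hcoef_separate], so it is square and invertible over E. In E[N], the
    group element x is the sum of the [q i x] times the basis vectors. *)
Lemma hbasis_inverse :
  exists q : 'I_(\dim {:descended}) -> nT -> M,
  [/\ forall i x, q i x \in E,
      forall x y, \sum_i q i x * hcoef y (e i) = (x == y)%:R,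
      forall i j : 'I_(\dim {:descended}),
        \sum_x q i x * hcoef x (e j) = (i == j)%:R
    & \dim {:descended} = #|nT|].
Proof.
pose P : 'M[subvs_of E]_(\dim {:descended}, #|nT|) :=
  \matrix_(i, j) vsproj E (hcoef (enum_val j) (e i)).
have PE i x : vsval (P i (enum_rank x)) = hcoef x (e i).
  by rewrite mxE enum_rankK vsprojK ?hcoefE.
have Pfree : row_free P.
  apply: inj_row_free => v vP0; apply/rowP => i; rewrite mxE; apply: val_inj.
  apply: (hbasis_independent (d := fun i => vsval (v 0 i))) => {i} [i|x].
    exact: subvsP.
  have /matrixP/(_ 0 (enum_rank x))/(congr1 vsval) := vP0.
  rewrite !mxE linear0 linear_sum => v0; rewrite -[RHS]v0.
  apply: eq_bigr => i _.
  by rewrite -PE.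
have Pfull : row_full P.
  rewrite /row_full -mxrank_tr; apply: inj_row_free => v vP0.
  apply/rowP => j; rewrite mxE -[j]enum_valK; apply: val_inj.
  pose d x := vsval (v 0 (enum_rank x)).
  apply: (hcoef_separate (d := d)) => h.
  rewrite (coord_vbasis (memvf h)).
  under eq_bigr => x _ do rewrite linear_sum mulr_sumr.
  rewrite exchange_big; apply: big1 => i _ /=.
  under eq_bigr => x _ do rewrite linearZ /= -scalerAr.
  rewrite -scaler_sumr (_ : \sum_x _ = 0) ?scaler0 //.
  have /matrixP/(_ 0 i)/(congr1 vsval) := vP0.
  rewrite !mxE linear0 linear_sum => v0; rewrite -[RHS]v0.
  rewrite (reindex enum_rank) /=; last by apply: onW_bij; apply: enum_rank_bij.
  by apply: eq_bigr => x _; rewrite -PE [in RHS]mxE.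
have dimP : \dim {:descended} = #|nT| by rewrite -(eqP Pfree) (eqP Pfull).
have [B BP] := row_fullP Pfull; have [B' PB'] := row_freeP Pfree.
have BB' : B = B' by rewrite -[B]mulmx1 -PB' mulmxA BP mul1mx.
exists (fun i x => vsval (B (enum_rank x) i)); split=> // [i x|x y|i j].
- exact: subvsP.
- have /matrixP/(_ (enum_rank x) (enum_rank y))/(congr1 vsval) := BP.
  rewrite !mxE (inj_eq enum_rank_inj) linear_sum rmorph_nat => <-.
  by apply: eq_bigr => i _; rewrite -PE.
have /matrixP/(_ j i)/(congr1 vsval) := PB'.
rewrite -BB' !mxE eq_sym linear_sum rmorph_nat => <-.
rewrite [RHS](reindex enum_rank) /=; last first.
  by apply: onW_bij; apply: enum_rank_bij.
by apply: eq_bigr => x _; rewrite -PE mulrC.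
Qed.

Lemma dim_descended : \dim {:descended} = #|nT|.
Proof. by have [q []] := hbasis_inverse. Qed.

(** Twisting [q] by [g] gives another inverse of the same matrix, because that matrix is
    equivariant; inverses are unique. *)
Lemma hinverse_equivariant (q : 'I_(\dim {:descended}) -> nT -> M) :
    (forall x y, \sum_i q i x * hcoef y (e i) = (x == y)%:R) ->
    (forall i j : 'I_(\dim {:descended}),
        \sum_x q i x * hcoef x (e j) = (i == j)%:R) ->
  forall (g : gal_of E) i x, g (q i x) = q i (act x g).
Proof.
move=> q_hcoef hcoef_q g i x; set y := act x g.
pose r z := g (q i (act z g^-1%g)).
have rq (j : 'I_(\dim {:descended})) : \sum_z r z * hcoef z (e j) = (i == j)%:R.
  rewrite -(hc_act_reindex g) -[RHS](rmorph_nat g) -hcoef_q rmorph_sum.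
  apply: eq_bigr => z _.
  by rewrite rmorphM /= gal_hcoef /r hc_actK.
transitivity (r y); first by rewrite /r hc_actK.
rewrite -(hsum_delta y r).
under eq_bigr => z _ do rewrite -q_hcoef mulr_sumr.
rewrite exchange_big (bigD1 i) //= [X in _ + X]big1 => [|j /negPf ji].
  under eq_bigr => z _ do rewrite mulrCA.
  by rewrite -mulr_sumr rq eqxx mulr1 addr0.
under eq_bigr => z _ do rewrite mulrCA.
by rewrite -mulr_sumr rq eq_sym ji mulr0.
Qed.

Variable q : 'I_(\dim {:descended}) -> nT -> M.
Hypothesis qE : forall i x, q i x \in E.
Hypothesis q_hcoef : forall x y, \sum_i q i x * hcoef y (e i) = (x == y)%:R.
Hypothesis hcoef_q : forall i j : 'I_(\dim {:descended}),
  \sum_x q i x * hcoef x (e j) = (i == j)%:R.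

Lemma hinverse_pair z (f : nT -> M) :
  \sum_i q i z * (\sum_x hcoef x (e i) * f x) = f z.
Proof.
under eq_bigr => i _ do rewrite mulr_sumr.
rewrite exchange_big /= -[RHS](hsum_delta z f); apply: eq_bigr => x _.
by rewrite -q_hcoef mulr_sumr; apply: eq_bigr => i _; rewrite mulrA mulrC.
Qed.

(** * The Hopf algebra of equivariant functions *)

(** Coordinates of the sum of the [hcoef z h] times z (x) z, each z being expanded in the descended
    basis through [q]. *)
Definition comul_fun (h : descended) : tensor descended descended :=
  \matrix_(i, j) scalar_of (\sum_z q i z * q j z * hcoef z h).

Lemma comul_fun_is_linear : linear comul_fun.
Proof.
move=> a u v; apply/matrixP => i j; rewrite !mxE -linearP scaler_sumr -big_split.
congr scalar_of; apply: eq_bigr => z _ /=.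
by rewrite linearP mulrDr scalerAr.
Qed.

HB.instance Definition _ := GRing.isLinear.Build k descended
  (tensor descended descended) _ comul_fun comul_fun_is_linear.

Definition comul : 'Hom(descended, tensor descended descended) :=
  linfun comul_fun.

Lemma comul_entry h i j :
  ((comul h : 'M_(_, _)) i j)%:A = \sum_z q i z * q j z * hcoef z h.
Proof.
rewrite lfunE mxE scalar_ofK //; apply: fixed_in1 => [|g].
  by apply: rpred_sum => z _; rewrite !rpredM ?hcoefE.
rewrite rmorph_sum -[RHS](hc_act_reindex g); apply: eq_bigr => z _.
by rewrite !rmorphM /= gal_hcoef !(hinverse_equivariant q_hcoef hcoef_q).
Qed.

(* After extension of scalars to M, comul h is \sum_x h x (delta_x (x)        *)
(* delta_x).                                                                  *)
Lemma tlift_comul (U : vectType k) (phi : {linear U -> M})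
    (f : descended -> descended -> U) (G : nT -> nT -> M) h :
    (forall a b, phi (f a b) =
      \sum_x \sum_y hcoef x a * (hcoef y b * G x y)) ->
  phi (tlift f (comul h)) = \sum_x hcoef x h * G x x.
Proof.
move=> fG; rewrite linear_sum.
transitivity (\sum_z hcoef z h * \sum_i q i z * (\sum_x hcoef x (e i) *
    \sum_j q j z * (\sum_y hcoef y (e j) * G x y))); last first.
  apply: eq_bigr => z _; congr (_ * _); rewrite hinverse_pair.
  exact: hinverse_pair.
under [RHS]eq_bigr => z _ do rewrite mulr_sumr.
rewrite [RHS]exchange_big; apply: eq_bigr => i _ /=.
rewrite linear_sum.
transitivity (\sum_j \sum_z (q i z * q j z * hcoef z h) *
    \sum_x \sum_y hcoef x (e i) * (hcoef y (e j) * G x y)).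
  apply: eq_bigr => j _; rewrite linearZ /= fG -mulr_suml -comul_entry.
  by rewrite -scalerAl mul1r.
rewrite exchange_big; apply: eq_bigr => z _ /=.
transitivity (\sum_j \sum_x hcoef z h * (q i z * (hcoef x (e i) *
   (q j z * \sum_y hcoef y (e j) * G x y)))).
  apply: eq_bigr => j _; rewrite mulr_sumr; apply: eq_bigr => x _.
  rewrite -mulr_sumr; move: (\sum_y _) => s.
  rewrite -!mulrA [RHS]mulrCA; congr (_ * _); rewrite mulrCA.
  by congr (_ * _); rewrite mulrCA.
rewrite exchange_big mulr_sumr mulr_sumr; apply: eq_bigr => x _ /=.
by rewrite -!mulr_sumr.
Qed.

Lemma sum_prod (A P B Q : nT -> M) :
  (\sum_x A x * P x) * (\sum_y B y * Q y) =
  \sum_x \sum_y A x * (B y * (P x * Q y)).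
Proof.
rewrite mulr_suml; apply: eq_bigr => x _; rewrite mulr_sumr.
by apply: eq_bigr => y _; rewrite -mulrA [P x * _]mulrCA.
Qed.

(** Applying [q] to the evaluations at all [x] recovers the values of the [r j] on every row of the
    tensor, and the [r j] separate W. *)
Lemma tensor_descended_inj (W : vectType k) (J : Type) (r : J -> {linear W -> M})
    (t u : tensor descended W) :
    (forall w w', (forall j, r j w = r j w') -> w = w') ->
    (forall x j, tlift (fun a w => hcoef x a * r j w) t =
                 tlift (fun a w => hcoef x a * r j w) u) ->
  t = u.
Proof.
move=> r_inj tu.
pose row_of (t : tensor descended W) i : W :=
  \sum_j (t : 'M_(_, _)) i j *: (vbasis {:W})`_j.
have evalE (s : tensor descended W) i j :
    r j (row_of s i) = \sum_x q i x * tlift (fun a w => hcoef x a * r j w) s.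
  transitivity (\sum_x q i x * \sum_(a < \dim {:descended})
      hcoef x (e a) * r j (row_of s a)); last first.
    apply: eq_bigr => x _; congr (_ * _); apply: eq_bigr => a _.
    rewrite linear_sum mulr_sumr; apply: eq_bigr => b _.
    by rewrite linearZ scalerAr.
  under [RHS]eq_bigr => x _ do rewrite mulr_sumr.
  rewrite exchange_big /= (bigD1 i) //= [X in _ + X]big1 => [|a /negPf ai].
    under eq_bigr => x _ do rewrite mulrA.
    by rewrite -mulr_suml hcoef_q eqxx mul1r addr0.
  under eq_bigr => x _ do rewrite mulrA.
  by rewrite -mulr_suml hcoef_q eq_sym ai mul0r.
have tu_row i : row_of t i = row_of u i.
  by apply: r_inj => j; rewrite !evalE; apply: eq_bigr => x _; rewrite tu.
apply/matrixP => i j; apply/eqP; rewrite -subr_eq0; apply/eqP.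
have /freeP bfree := basis_free (vbasisP {:W}).
apply: (bfree (fun j => (t : 'M_(_, _)) i j - (u : 'M_(_, _)) i j)).
under eq_bigr => l _ do rewrite scalerBl.
by rewrite sumrB; apply/eqP; rewrite subr_eq0; apply/eqP/tu_row.
Qed.

Local Notation coef2 x y := (tlift (fun a b => hcoef x a * hcoef y b)).

Lemma coef2_inj (t u : tensor descended descended) :
  (forall x y, coef2 x y t = coef2 x y u) -> t = u.
Proof. by apply: tensor_descended_inj; apply: hcoef_inj. Qed.

Lemma coef3_inj (t u : tensor descended (tensor descended descended)) :
    (forall x y z, tlift (fun a s => hcoef x a * coef2 y z s) t =
                   tlift (fun a s => hcoef x a * coef2 y z s) u) ->
  t = u.
Proof.
move=> tu; apply: (tensor_descended_inj (J := nT * nT)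
    (r := fun yz => coef2 yz.1 yz.2)) => [s s' ss'|x [y z]]; last exact: tu.
by apply: coef2_inj => y z; apply: (ss' (y, z)).
Qed.

Lemma coef2_ptensor x y a b : coef2 x y (ptensor a b) = hcoef x a * hcoef y b.
Proof. exact: tlift_ptensor. Qed.

Lemma coef3_ptensor x y z a s :
  tlift (fun a s => hcoef x a * coef2 y z s) (ptensor a s) =
  hcoef x a * coef2 y z s.
Proof. exact: tlift_ptensor. Qed.

Lemma coef2_comul x y h :
  coef2 x y (comul h) = \sum_z hcoef z h * ((z == x)%:R * (z == y)%:R).
Proof.
have -> : comul h = tlift (fun a b => ptensor a b) (comul h).
  rewrite [LHS](@matrix_sum_delta _ (\dim {:descended}) (\dim {:descended})).
  apply: eq_bigr => i _; apply: eq_bigr => j _; congr (_ *: _).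
  apply/matrixP => a b.
  rewrite !mxE !coord_free ?(basis_free (vbasisP _)) // -natrM mulnb.
  by rewrite [a == i]eq_sym [b == j]eq_sym.
apply: (tlift_comul (G := fun u v => (u == x)%:R * (v == y)%:R)) => a b.
by rewrite /= coef2_ptensor -sum_prod -!hcoef_pair.
Qed.

Definition counit_fun (h : descended) : k^o := scalar_of (\sum_x hcoef x h).

Lemma counit_fun_is_linear : linear counit_fun.
Proof.
move=> a u v; rewrite /counit_fun -linearP scaler_sumr -big_split.
rewrite (eq_bigr (fun x => a *: hcoef x u + hcoef x v)) // => x _.
by rewrite linearP.
Qed.

HB.instance Definition _ :=
  GRing.isLinear.Build k descended k^o _ counit_fun counit_fun_is_linear.

Definition counit : 'Hom(descended, k^o) := linfun counit_fun.

Lemma counitE h : (counit h : k)%:A = \sum_x hcoef x h.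
Proof.
rewrite lfunE /= scalar_ofK //; apply: fixed_in1 => [|g].
  by apply: rpred_sum => z _; rewrite hcoefE.
rewrite rmorph_sum -[RHS](hc_act_reindex g); apply: eq_bigr => z _.
by rewrite /= gal_hcoef.
Qed.

Definition antipode_fun (h : descended) : descended :=
  hbuild (fun x => hcoef x^-1%g h).

Lemma hcoef_antipode_fun x h : hcoef x (antipode_fun h) = hcoef x^-1%g h.
Proof.
apply: (hbuildE (f := fun x => hcoef x^-1%g h)) => {x} [x|g x].
  exact: hcoefE.
by rewrite gal_hcoef hc_actV.
Qed.

Lemma antipode_fun_is_linear : linear antipode_fun.
Proof.
move=> a u v; apply: hcoef_inj => x.
by rewrite linearP /= !hcoef_antipode_fun linearP.
Qed.

HB.instance Definition _ := GRing.isLinear.Build k descended descended _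
  antipode_fun antipode_fun_is_linear.

Definition antipode : 'End(descended) := linfun antipode_fun.

Lemma hcoef_antipode x h : hcoef x (antipode h) = hcoef x^-1%g h.
Proof. by rewrite lfunE hcoef_antipode_fun. Qed.

Lemma pair_const (h : descended) (c : M) :
  \sum_x hcoef x h * c = (counit h : k)%:A * c.
Proof. by rewrite -mulr_suml counitE. Qed.

Lemma hcoefM_l a b z :
  hcoef z (a * b) = \sum_y hcoef y b * (\sum_x hcoef x a * ((x * y)%g == z)%:R).
Proof.
rewrite hcoef_pair hpairM exchange_big; apply: eq_bigr => y _ /=.
by rewrite mulr_sumr; apply: eq_bigr => x _; rewrite mulrCA.
Qed.

Lemma comulA h :
  tlift (fun a b => tlift (fun a1 a2 => ptensor a1 (ptensor a2 b)) (comul a))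
    (comul h)
  = tlift (fun a b => ptensor a (comul b)) (comul h).
Proof.
apply: coef3_inj => x y z.
rewrite (tlift_comul (G := fun u v =>
    ((u == x)%:R * (u == y)%:R) * (v == z)%:R)).
  rewrite (tlift_comul (G := fun u v =>
      (u == x)%:R * ((v == y)%:R * (v == z)%:R))).
    by apply: eq_bigr => u _; rewrite -[X in _ * X = _]mulrA.
  by move=> a b; rewrite /= coef3_ptensor coef2_comul -sum_prod -hcoef_pair.
move=> a b.
rewrite -sum_prod -hcoef_pair.
rewrite (tlift_comul (G := fun u v => (u == x)%:R * ((v == y)%:R * hcoef z b))).
  by rewrite mulr_suml; apply: eq_bigr => u _; rewrite -!mulrA.
move=> a1 a2; rewrite /= coef3_ptensor coef2_ptensor -sum_prod -hcoef_pair.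
by under [in RHS]eq_bigr => u _ do rewrite mulrA; rewrite -mulr_suml -hcoef_pair.
Qed.

Lemma comul_counitl h :
  tlift (fun a b => (counit a : k) *: b) (comul h) = h.
Proof.
apply: hcoef_inj => z.
rewrite (tlift_comul (G := fun u v => 1 * (v == z)%:R)).
  by rewrite [RHS]hcoef_pair; under eq_bigr => u _ do rewrite mul1r.
move=> a b; rewrite /= linearZ /= -sum_prod -hcoef_pair pair_const mulr1.
by rewrite -scalerAl mul1r.
Qed.

Lemma comul_counitr h :
  tlift (fun a b => (counit b : k) *: a) (comul h) = h.
Proof.
apply: hcoef_inj => z.
rewrite (tlift_comul (G := fun u v => (u == z)%:R * 1)).
  by rewrite [RHS]hcoef_pair; under eq_bigr => u _ do rewrite mulr1.
move=> a b; rewrite /= linearZ /= -sum_prod -hcoef_pair pair_const mulr1.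
by rewrite -scalerAr mulr1.
Qed.

Lemma comul1 : comul 1 = ptensor 1 1.
Proof.
apply: coef2_inj => x y; rewrite coef2_comul coef2_ptensor !hcoef1.
rewrite (bigD1 1%g) //= hcoef1 eqxx mul1r big1 => [|z /negPf z1]; last first.
  by rewrite hcoef1 z1 mul0r.
by rewrite addr0 ![1%g == _]eq_sym.
Qed.

Lemma comulM g h : comul (g * h) =
  tlift (fun g1 g2 =>
    tlift (fun h1 h2 => ptensor (g1 * h1) (g2 * h2)) (comul h)) (comul g).
Proof.
apply: coef2_inj => x y; rewrite coef2_comul hpairM.
rewrite (tlift_comul (G := fun u v =>
    \sum_w hcoef w h * (((u * w)%g == x)%:R * ((v * w)%g == y)%:R))).
  by apply: eq_bigr => u _; rewrite -mulr_sumr.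
move=> g1 g2; rewrite (tlift_comul (G := fun u v =>
    (\sum_w hcoef w g1 * ((w * u)%g == x)%:R) *
    (\sum_w hcoef w g2 * ((w * v)%g == y)%:R))).
  under eq_bigr => w _ do rewrite sum_prod mulr_sumr.
  rewrite exchange_big; apply: eq_bigr => u _ /=.
  under eq_bigr => w _ do rewrite mulr_sumr.
  rewrite exchange_big; apply: eq_bigr => v _ /=.
  rewrite !mulr_sumr; apply: eq_bigr => w _.
  by rewrite mulrCA; congr (_ * _); rewrite mulrCA.
by move=> h1 h2; rewrite /= coef2_ptensor !hcoefM_l sum_prod.
Qed.

Lemma counit1 : counit 1 = 1.
Proof.
rewrite -[LHS](@scalar_ofA k M) counitE (bigD1 1%g) //= hcoef1 eqxx.
rewrite big1 => [|x /negPf x1].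
  by rewrite addr0 -[1 in LHS]scale1r (@scalar_ofA k M).
by rewrite hcoef1 x1.
Qed.

Lemma counitM g h : counit (g * h) = counit g * counit h.
Proof.
apply: (can_inj (@scalar_ofA k M)); rewrite /= counitE.
under eq_bigr => z _ do rewrite -[hcoef z _]mulr1.
rewrite hpairM -scalerA -[X in _ = _ *: X]mul1r scalerAl !counitE.
rewrite mulr_suml; apply: eq_bigr => x _; rewrite mulr_sumr.
by apply: eq_bigr => y _; rewrite mulr1.
Qed.

Lemma hcoef_scalar1 z (c : k) : hcoef z (c *: 1) = c%:A * (z == 1%g)%:R.
Proof. by rewrite linearZ /= hcoef1 -scalerAl mul1r. Qed.

Lemma antipodel h :
  tlift (fun a b => antipode a * b) (comul h) = (counit h : k) *: 1.
Proof.
apply: hcoef_inj => z.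
rewrite (tlift_comul (G := fun u v => ((u^-1 * v)%g == z)%:R)).
  under eq_bigr => u _ do rewrite mulVg.
  by rewrite pair_const hcoef_scalar1 eq_sym.
move=> a b; rewrite /= [LHS]hcoef_pair hpairM [LHS](reindex_inj invg_inj).
apply: eq_bigr => x _; apply: eq_bigr => y _ /=.
by rewrite hcoef_antipode invgK.
Qed.

Lemma antipoder h :
  tlift (fun a b => a * antipode b) (comul h) = (counit h : k) *: 1.
Proof.
apply: hcoef_inj => z.
rewrite (tlift_comul (G := fun u v => ((u * v^-1)%g == z)%:R)).
  under eq_bigr => u _ do rewrite mulgV.
  by rewrite pair_const hcoef_scalar1 eq_sym.
move=> a b; rewrite /= [LHS]hcoef_pair hpairM; apply: eq_bigr => x _.
rewrite [LHS](reindex_inj invg_inj).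
by apply: eq_bigr => y _ /=; rewrite hcoef_antipode invgK.
Qed.

Lemma comulC h : tlift (fun a b => ptensor b a) (comul h) = comul h.
Proof.
apply: coef2_inj => x y; rewrite coef2_comul.
rewrite (tlift_comul (G := fun u v => (u == y)%:R * (v == x)%:R)).
  by apply: eq_bigr => u _; rewrite [X in _ * X]mulrC.
by move=> a b; rewrite /= coef2_ptensor -sum_prod -!hcoef_pair mulrC.
Qed.

Definition descended_hopf : cocomHopf k :=
  @CocomHopf k descended comul counit antipode comulA comul_counitl comul_counitr
    comul1 comulM counit1 counitM antipodel antipoder comulC.

(** * The action on the intermediate field *)

Hypothesis sFE : (F <= E)%VS.

(** The cocycle identity makes the fibres of [tau] the cosets of Gal(E/F), so the [sec x] represent
    the distinct embeddings of F. *)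
Lemma hc_cocycle_coset g x :
  (tau (g * sec x)%g == x) = (g \in 'Gal(E / F)%g).
Proof.
rewrite hc_cocycleM hc_sectionK -[X in _ == X]mulg1 (inj_eq (mulgI x)).
rewrite -[X in _ == X](hc_act1g (sec x)) hc_act_eq.
by apply/eqP/idP => /(hc_cocycle1 D).
Qed.

Lemma section_cocycle g a : a \in F -> sec (tau g) a = g a.
Proof.
move=> aF; have aE := subvP sFE _ aF.
rewrite -[g in RHS](mulgKV (sec (tau g))) galM //.
rewrite [X in _ = _ X](fixed_gal sFE _ aF) //.
by rewrite -(hc_cocycle_coset _ (tau g)) mulgKV.
Qed.

(** Apply the hypothesis to traces from E to F: grouping Gal(E/k) by the fibres of [tau] turns it
    into a relation between automorphisms of E. *)
Lemma section_independence (d : nT -> M) :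
  (forall a, a \in F -> \sum_x d x * sec x a = 0) -> forall x, d x = 0.
Proof.
move=> d0 x; rewrite -[x](hc_sectionK D).
apply: (gal_independence (d := fun g => d (tau g))) => b bE.
have galF : galois F E by apply: galoisS galE; rewrite sub1v.
rewrite -[RHS](d0 (galTrace F E b)) ?mem_galTrace //.
rewrite (partition_big tau predT) //=; apply: eq_bigr => y _.
rewrite rmorph_sum mulr_sumr (reindex_inj (mulIg (sec y))) /=.
apply: eq_big => [g|g /eqP ->]; first exact: hc_cocycle_coset.
by rewrite galM.
Qed.

Definition action_val (h : descended) (a : M) : M :=
  \sum_x hcoef x h * sec x a.

Lemma action_val_in h a : a \in F -> action_val h a \in F.
Proof.
move=> aF; have aE := subvP sFE _ aF.
have /galois_fixedField <- : galois F E by apply: galoisS galE; rewrite sub1v.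
apply/fixedFieldP => [|g gF].
  by apply: rpred_sum => x _; rewrite rpredM ?hcoefE ?memv_gal.
rewrite rmorph_sum -[RHS](hc_act_reindex g); apply: eq_bigr => x _.
rewrite rmorphM /= gal_hcoef -galM // -section_cocycle // hc_cocycleM hc_sectionK.
by move/(hc_cocycle1 D): gF => ->; rewrite mul1g.
Qed.

Definition action_fun h (a : subvs_of F) : subvs_of F :=
  vsproj F (action_val h (vsval a)).

Lemma action_funE h a : vsval (action_fun h a) = action_val h (vsval a).
Proof. by rewrite vsprojK ?action_val_in ?subvsP. Qed.

Lemma action_fun_is_linear h : linear (action_fun h).
Proof.
move=> c a b; apply: val_inj; rewrite [LHS]action_funE !linearP /= !action_funE.
rewrite scaler_sumr -big_split; apply: eq_bigr => x _ /=.
by rewrite linearP mulrDr scalerAr.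
Qed.

HB.instance Definition _ h := GRing.isLinear.Build k (subvs_of F) (subvs_of F) _
  (action_fun h) (action_fun_is_linear h).

Definition action_map h : 'End(subvs_of F) := linfun (action_fun h).

Lemma action_map_is_linear : linear action_map.
Proof.
move=> c g h; apply/lfunP => a; apply: val_inj.
rewrite !lfun_simp /= !action_funE scaler_sumr -big_split.
by apply: eq_bigr => x _ /=; rewrite linearP mulrDl scalerAl.
Qed.

HB.instance Definition _ := GRing.isLinear.Build k descended 'End(subvs_of F) _
  action_map action_map_is_linear.

Definition action : 'Hom(descended, 'End(subvs_of F)) := linfun action_map.

Lemma actionE h a : vsval (action h a) = \sum_x hcoef x h * sec x (vsval a).
Proof. by rewrite /action lfunE /= /action_map lfunE /= action_funE. Qed.

Lemma action_module_algebra :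
  module_algebra (action : 'Hom(descended_hopf, 'End(subvs_of F))).
Proof.
split=> [|g h|h|h s t].
- apply/lfunP => a; apply: val_inj; rewrite [LHS]actionE id_lfunE.
  rewrite (bigD1 1%g) //= hcoef1 eqxx mul1r big1 => [|x /negPf x1].
    have tau1 : tau 1%g = 1%g by apply/(hc_cocycle1 D); rewrite group1.
    by rewrite addr0 -tau1 section_cocycle ?subvsP // gal_id.
  by rewrite hcoef1 x1 mul0r.
- apply/lfunP => a; apply: val_inj; rewrite comp_lfunE [LHS]actionE [RHS]actionE.
  rewrite (hpairM g h (fun x => sec x (vsval a))); apply: eq_bigr => x _.
  rewrite actionE -mulr_sumr -(hc_act_reindex (sec x)) rmorph_sum.
  congr (_ * _); apply: eq_bigr => y _.
  rewrite rmorphM /= gal_hcoef -galM ?(subvP sFE) ?subvsP //.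
  congr (_ * _).
  by rewrite -[RHS]section_cocycle ?subvsP // hc_cocycleM !hc_sectionK.
- apply: val_inj; rewrite [LHS]actionE [RHS]linearZ /= algid1 counitE.
  by apply: eq_bigr => x _; rewrite rmorph1 mulr1.
rewrite -[LHS]/(action h (s * t)); apply: val_inj.
rewrite [LHS]actionE (tlift_comul (phi := vsval)
  (G := fun x y => sec x (vsval s) * sec y (vsval t))).
  by apply: eq_bigr => x _; rewrite rmorphM.
by move=> a b; rewrite /= !actionE sum_prod.
Qed.

Hypothesis cardF : #|nT| = \dim F.

(** Both sides have dimension the square of [\dim F], so injectivity suffices. On a kernel element,
    independence of embeddings, then of the descended basis over E, then of the basis of F,
    successively kill the coefficients. *)
Lemma action_bijective :
  bijective (hopf_galois_map (action : 'Hom(descended_hopf, 'End(subvs_of F)))).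
Proof.
set j := hopf_galois_map _.
pose jl : 'Hom(tensor (subvs_of F) descended, 'End(subvs_of F)) := linfun (tlift
  (fun (s : subvs_of F) (h : descended) => (amull s \o action h)%VF)).
have jE t : j t = jl t by rewrite lfunE.
suff jl0 : lker jl = 0%VS.
  have full : (limg jl = fullv)%VS.
    apply/eqP; rewrite eqEdim subvf /= limg_dim_eq ?jl0 ?capv0 // !dimvf.
    rewrite dim_lfun dim_tensor -[dim (descended)]dimvf dim_descended cardF.
    exact: leqnn.
  exists (jl^-1)%VF => t; rewrite jE.
    by apply: lker0_lfunK; rewrite jl0.
  by apply: limg_lfunVK; rewrite full memvf.
apply/eqP; rewrite -subv0; apply/subvP => t; rewrite memv_ker memv0 => /eqP jt0.
apply/eqP/matrixP => i l; rewrite [RHS]mxE.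
pose d l := \sum_i (t : 'M_(_, _)) i l *: vsval (vbasis {:subvs_of F})`_i.
have dE l' : d l' \in E.
  by apply: rpred_sum => i' _; rewrite rpredZ // (subvP sFE) ?subvsP.
have d0 : d l = 0.
  apply: (hbasis_independent (d := d)) => // x.
  apply: (section_independence 
    (d := fun x => \sum_l d l * hcoef x (e l))) => a aF {x}.
  have := congr1 (fun f : 'End(_) => vsval (f (vsproj F a))) jt0.
  rewrite lfunE /= zero_lfunE linear0 => jt; rewrite -[RHS]jt.
  rewrite sum_lfunE linear_sum.
  under [RHS]eq_bigr => i' _ do rewrite sum_lfunE linear_sum.
  rewrite exchange_big /=.
  under eq_bigr => x _ do rewrite mulr_suml.
  rewrite exchange_big; apply: eq_bigr => l' _ /=.
  under [RHS]eq_bigr => i' _ do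
    rewrite !lfun_simp linearZ /= action_funE vsprojK // scalerAl.
  rewrite -[RHS]mulr_suml mulr_sumr; apply: eq_bigr => x _.
  by rewrite mulrA.
have /freeP bfree := basis_free (vbasisP {:subvs_of F}).
apply: (bfree (fun i => (t : 'M_(_, _)) i l)); apply: val_inj.
rewrite linear0 linear_sum -[RHS]d0; apply: eq_bigr => i' _.
by rewrite linearZ.
Qed.

Definition descended_hgs : hopfGaloisStructure (subvs_of F) :=
  HopfGaloisStructure action_module_algebra action_bijective.

End EquivariantFunctions.

(** The two clauses describe the image of H in End(F), through which two structures are compared. *)
Lemma holomorph_hopf_galois (k : fieldType) (M : splittingFieldType k)
    (E F : {subfield M}) (nT : finGroupType) (D : holomorph_cocycle E F nT) :
    galois 1 E -> (F <= E)%VS -> #|nT| = \dim F ->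
  exists S : hopfGaloisStructure (subvs_of F),
    (forall s : hgs_hopf S, exists h : descended D, forall a,
       vsval (hgs_act S s a) = \sum_x hcoef x h * hc_section D x (vsval a)) /\
    (forall h : descended D, exists s : hgs_hopf S, forall a,
       vsval (hgs_act S s a) = \sum_x hcoef x h * hc_section D x (vsval a)).
Proof.
move=> galE sFE cardF; have [q [qE q_hcoef hcoef_q _]] := hbasis_inverse D galE.
exists (descended_hgs galE qE q_hcoef hcoef_q sFE cardF).
by split=> h; exists h => a; apply: actionE.
Qed.

(** * Two cocycles with values in a dihedral group *)

Section SquareCocycles.

Variables (k : fieldType) (M : splittingFieldType k) (E F : {subfield M}).
(** In the application [pi] is the projection of P ><| C onto C, and [D] is the preimage of
    Gal(E/F). *)
Variables (D : {group gal_of E}) (pi : gal_of E -> gal_of E).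
Hypothesis piM : {morph pi : x y / (x * y)%g}.
Hypothesis piC : forall x y, commute (pi x) (pi y).
Hypothesis pi_idem : forall x, pi (pi x) = pi x.
Hypothesis pi_galF : {in 'Gal(E / F)%g, forall x, pi x = x}.
Hypothesis pi_sqr : forall x, (pi x * pi x)%g \in 'Gal(E / F)%g.
Hypothesis pi_sqr1 : forall x,
  (pi x * pi x)%g = 1%g <-> pi x \in 'Gal(E / F)%g.
Hypothesis pi_root : forall x, x \in 'Gal(E / F)%g ->
  exists2 y, pi y = y & (y * y)%g = x.
Hypothesis memD : forall x, (x \in D) = (pi x \in 'Gal(E / F)%g).

Lemma pi1 : pi 1%g = 1%g.
Proof. by rewrite pi_galF. Qed.

Lemma piV x : pi x^-1%g = (pi x)^-1%g.
Proof. by apply: (mulgI (pi x)); rewrite -piM !mulgV pi1. Qed.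

Lemma memD_conj x g : x \in D -> (x ^ g)%g \in D.
Proof.
by rewrite !memD conjgE !piM piV (piC x) mulKg.
Qed.

Definition conj_act (x : subg_of D) (g : gal_of E) : subg_of D :=
  subg D (sgval x ^ g).

Lemma conj_actE x g : sgval (conj_act x g) = (sgval x ^ g)%g.
Proof. by rewrite subgK // memD_conj ?subgP. Qed.

Lemma conj_actM g : {morph conj_act^~ g : x y / (x * y)%g}.
Proof. by move=> x y; apply: val_inj; rewrite /= !conj_actE /= conjMg. Qed.

Lemma conj_act1 x : conj_act x 1%g = x.
Proof. by apply: val_inj; rewrite /= conj_actE conjg1. Qed.

Lemma conj_actA x g h : conj_act x (g * h)%g = conj_act (conj_act x g) h.
Proof. by apply: val_inj; rewrite /= !conj_actE conjgM. Qed.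

Definition sqr_cocycle (g : gal_of E) : subg_of D := subg D (pi g * g).

Lemma sqr_cocycleE g : sgval (sqr_cocycle g) = (pi g * g)%g.
Proof. by rewrite subgK // memD piM pi_idem pi_sqr. Qed.

Lemma sqr_cocycleM g h :
  sqr_cocycle (g * h)%g = (sqr_cocycle h * conj_act (sqr_cocycle g) h)%g.
Proof.
apply: val_inj; rewrite /= conj_actE !sqr_cocycleE piM conjgE piC.
by rewrite !mulgA mulgK.
Qed.

Lemma sqr_cocycle1 g : sqr_cocycle g = 1%g <-> g \in 'Gal(E / F)%g.
Proof.
split=> [/(congr1 sgval)/=|gF].
  rewrite sqr_cocycleE => g1.
  have gV : g = (pi g)^-1%g by apply: (mulgI (pi g)); rewrite mulgV.
  have : pi g \in 'Gal(E / F)%g.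
    (* Applying [pi] to [gV] shows that [pi g] is its own inverse. *)
    by apply/pi_sqr1; rewrite {2}gV piV pi_idem mulgV.
  by rewrite {2}gV groupV.
apply: val_inj; rewrite /= sqr_cocycleE.
have piF : pi g \in 'Gal(E / F)%g by rewrite pi_galF.
by rewrite -{2}(pi_galF gF); apply/pi_sqr1.
Qed.

Lemma sqr_cocycle_surj (x : subg_of D) : exists g, sqr_cocycle g = x.
Proof.
have /pi_root[y piy yy] : pi (sgval x) \in 'Gal(E / F)%g by rewrite -memD subgP.
(* As [pi x] is the square of [y], this element projects to [y], which cancels the factor [y^-1]. *)
exists (y^-1 * sgval x)%g; apply: val_inj.
by rewrite /= sqr_cocycleE piM piV piy -yy !mulgA mulVg mul1g mulgV mul1g.
Qed.

Variable sec : subg_of D -> gal_of E.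
Hypothesis secK : cancel sec sqr_cocycle.

Definition conj_cocycle : holomorph_cocycle E F (subg_of D) :=
  HolomorphCocycle conj_actM conj_act1 conj_actA sqr_cocycleM sqr_cocycle1 secK.

(* The cocycle for the opposite group structure on D: it corresponds to the   *)
(* centralizer of the regular subgroup given by conj_cocycle.                 *)
Definition opp_act (x : subg_of D) (g : gal_of E) : subg_of D :=
  conj_act x (pi g)^-1%g.

Definition opp_sqr_cocycle (g : gal_of E) : subg_of D := (sqr_cocycle g)^-1%g.

Lemma opp_actM g : {morph opp_act^~ g : x y / (x * y)%g}.
Proof. exact: conj_actM. Qed.

Lemma opp_act1 x : opp_act x 1%g = x.
Proof. by rewrite /opp_act pi1 invg1 conj_act1. Qed.

Lemma opp_actA x g h : opp_act x (g * h)%g = opp_act (opp_act x g) h.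
Proof. by rewrite /opp_act -conj_actA -invMg -piC -piM. Qed.

Lemma opp_sqr_cocycleM g h : opp_sqr_cocycle (g * h)%g =
  (opp_sqr_cocycle h * opp_act (opp_sqr_cocycle g) h)%g.
Proof.
apply: val_inj; rewrite /= conj_actE /= !sqr_cocycleE piM conjgE piC invgK.
by rewrite !invMg !mulgA mulgKV.
Qed.

Lemma opp_sqr_cocycle1 g : opp_sqr_cocycle g = 1%g <-> g \in 'Gal(E / F)%g.
Proof.
split=> [/eqP|/sqr_cocycle1 g1]; first by rewrite invg_eq1 => /eqP/sqr_cocycle1.
by rewrite /opp_sqr_cocycle g1 invg1.
Qed.

Lemma opp_secK : cancel (sec \o invg) opp_sqr_cocycle.
Proof. by move=> x; rewrite /opp_sqr_cocycle secK invgK. Qed.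

Definition opp_cocycle : holomorph_cocycle E F (subg_of D) :=
  HolomorphCocycle opp_actM opp_act1 opp_actA opp_sqr_cocycleM opp_sqr_cocycle1
    opp_secK.

Hypothesis galE : galois 1 E.
Hypothesis sFE : (F <= E)%VS.

(* If the images of the two Hopf algebras in End(F) coincide, the equivariant *)
(* functions for conj_cocycle take values fixed by the kernel of pi, which    *)
(* therefore centralizes D.                                                   *)
Lemma conj_opp_image (x : subg_of D) (p : gal_of E) :
    pi p = 1%g ->
    (forall h : descended conj_cocycle, exists h' : descended opp_cocycle,
      forall a, a \in F ->
        \sum_x hcoef x h * hc_section conj_cocycle x a =
        \sum_x hcoef x h' * hc_section opp_cocycle x a) ->
  conj_act x p = x.
Proof.
move=> pip sub_im.
have fix_h (h : descended conj_cocycle) : hcoef (conj_act x p) h = hcoef x h.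
  have [h' hh'] := sub_im h.
  have hV y : hcoef y h = hcoef y^-1%g h'.
    apply/eqP; rewrite -subr_eq0; apply/eqP.
    apply: (section_independence (D := conj_cocycle)
      (d := fun y => hcoef y h - hcoef y^-1%g h') galE sFE) => a aF {y}.
    under eq_bigr => y _ do rewrite mulrBl.
    rewrite sumrB hh' // (reindex_inj invg_inj) /=.
    by under eq_bigr => y _ do rewrite invgK; rewrite subrr.
  (* Acting by [p] on coefficients moves the index of [h] by conjugation but leaves that of [h'],
     since [opp_act] factors through [pi]. *)
  rewrite -[LHS](gal_hcoef p x h) hV (gal_hcoef p x^-1%g h') /=.
  by rewrite /opp_act pip invg1 conj_act1.
have d0 : (conj_act x p == x)%:R - (x == x)%:R = 0 :> M.
  pose d y : M := (conj_act x p == y)%:R - (x == y)%:R.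
  rewrite -[LHS]/(d x).
  apply: (hcoef_separate (D := conj_cocycle) (d := d)) => h.
  under eq_bigr => y _ do rewrite mulrC mulrBr.
  by rewrite sumrB !(hsum_delta _ (fun y => hcoef y h)) fix_h subrr.
apply/eqP/negbNE/negP => /negPf xp; move/eqP: d0.
by rewrite xp eqxx sub0r oppr_eq0 oner_eq0.
Qed.

Hypothesis cardD : #|D| = \dim F.

Lemma two_hopf_galois_structures x p :
  x \in D -> pi p = 1%g -> (x ^ p)%g <> x ->
  exists S1 S2 : hopfGaloisStructure (subvs_of F), ~ hgs_iso S1 S2.
Proof.
move=> xD pip xp.
have cardF : #|subg_of D| = \dim F.
  by rewrite -cardD -cardsT (card_isog (isog_subg D)).
have [S1 [_ S1h]] := holomorph_hopf_galois conj_cocycle galE sFE cardF.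
have [S2 [S2h _]] := holomorph_hopf_galois opp_cocycle galE sFE cardF.
exists S1, S2 => -[phi [_ phiE]]; apply: xp.
rewrite -[x in RHS](subgK x xD) -(@conj_opp_image (subg D x) p pip)
  ?conj_actE ?subgK ?memD_conj //.
move=> h; have [s hs] := S1h h; have [h' hh'] := S2h (phi s).
exists h' => a aF; rewrite -[a](vsprojK aF).
by rewrite -hs -hh' phiE.
Qed.

End SquareCocycles.

(** * Galois groups of order 20 *)

Section OrderTwenty.

Local Open Scope group_scope.

Variables (gT : finGroupType) (G C : {group gT}).
Hypothesis cardG : #|G| = 20.
Hypothesis cardC : #|C| = 4.
Hypothesis sCG : C \subset G.
Hypothesis coreC : forall N : {group gT}, N <| G -> N \subset C -> N :=: 1.

Lemma order4_abelian : abelian C.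
Proof. by apply: (@card_p2group_abelian _ 2); rewrite ?cardC. Qed.

(** Among the divisors of 20 only 1 is congruent to 1 modulo 5. *)
Lemma normal_Sylow5 : exists2 P : {group gT}, P <| G & #|P| = 5.
Proof.
suff /(normal_sylowP 5 G)[P sylP nPG] : #|'Syl_5(G)| == 1%N.
  by exists P => //; rewrite (card_Hall sylP) cardG p_part.
have := card_Syl_mod G (isT : prime 5); have := card_Syl_dvd 5 G.
rewrite cardG; move: #|_| => n n20.
have : n \in divisors 20 by rewrite -dvdn_divisors.
by rewrite !inE; do ?[case/orP]; move/eqP=> ->.
Qed.

(** The subgroup C :&: 'C(P) is centralized by P and normalized by the abelian C, hence normal in G
    and trivial by [coreC]. So C embeds in Aut P, which is cyclic because P has prime order. *)
Lemma order20_structure : exists P : {group gT},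
  [/\ P <| G, P ><| C = G, cyclic C & C :&: 'C(P) = 1].
Proof.
have [P nPG cardP] := normal_Sylow5.
have nPC : C \subset 'N(P) := subset_trans sCG (normal_norm nPG).
have PC1 : P :&: C = 1 by apply: coprime_TIg; rewrite cardP cardC.
have PCG : P * C = G :> {set gT}.
  apply/eqP; rewrite eqEcard mul_subG ?sCG ?(normal_sub nPG) //=.
  by rewrite (TI_cardMg PC1) cardP cardC cardG.
have centC1 : C :&: 'C(P) = 1.
  apply: (coreC (N := [group of C :&: 'C(P)])); last exact: subsetIl.
  rewrite /normal subIset ?sCG //= -PCG mul_subG //.
    by rewrite cents_norm // centsC subsetIr.
  by rewrite sub_abelian_norm ?order4_abelian ?subsetIl.
exists P; split=> //; first by rewrite sdprodE.
have prP : prime #|P| by rewrite cardP.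
have inj : 'injm (restrm nPC (conj_aut P)).
  by rewrite ker_restrm ker_conj_aut centC1.
rewrite -(injm_cyclic inj) //; apply: cyclicS (Aut_prime_cyclic prP).
by rewrite /= morphim_restrm Aut_conj_aut.
Qed.

Variable A : {group gT}.
Hypothesis sAC : A \subset C.
Hypothesis cardA : #|A| = 2.

(** A is the unique subgroup of order 2, which is both the image and the kernel of squaring on C. *)
Lemma cyclic_order4_sqr : cyclic C ->
  [/\ {in C, forall x, x * x \in A},
      {in C, forall x, x * x = 1 <-> x \in A}
    & {in A, forall x, exists2 y, y \in C & y * y = x}].
Proof.
case/cyclicP=> c defC.
have oc : #[c] = 4 by rewrite orderE -defC cardC.
have defA : A :=: <[c * c]>.
  apply/eqP; rewrite (eq_subG_cyclic (G := C)) //.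
  - by rewrite cardA -[c * c]/(c ^+ 2) -orderE (orderXdiv (n := 2)) ?oc.
  - by apply/cyclicP; exists c.
  by rewrite defC cycle_subG groupM ?cycle_id.
have sqr i : (c ^+ i) * (c ^+ i) = (c * c) ^+ i by rewrite expgMn.
split=> [x|x|x]; rewrite ?defC ?defA => /cycleP[i ->].
- by rewrite sqr mem_cycle.
- split=> [|ciA].
    rewrite -expgD addnn => /eqP; rewrite -order_dvdn oc => i4.
    have /dvdnP[j ->] : (2 %| i)%N by rewrite -(@dvdn_pmul2l 2) // !mul2n.
    by rewrite mulnC expgM mem_cycle.
  have: (c ^+ i) ^+ #|A| = 1 by rewrite expg_cardG // defA.
  by rewrite cardA.
by exists (c ^+ i); rewrite ?mem_cycle ?sqr.
Qed.

End OrderTwenty.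

(** * Galois closures and regular groups of translations *)

(** The fixed field of N is Galois over k and contains L, so by minimality it is all of E. *)
Lemma galois_closure_core (k : fieldType) (M : splittingFieldType k)
    (L E : {subfield M}) (N : {group gal_of E}) :
    galois_closure L E -> (N <| 'Gal(E / 1))%g -> (N \subset 'Gal(E / L))%g ->
  N :=: 1%g.
Proof.
case=> sLE galE minE nN sNL; apply/eqP; rewrite trivg_card1.
have sEN : (E <= fixedField N)%VS.
  apply: (minE [aspace of fixedField N]); first by rewrite -galois_connection.
  exact: (normal_fixedField_galois (K := 1%AS) galE nN).
rewrite (dim_fixedField N) (_ : fixedField N = E :> {vspace M}) ?divnn ?adim_gt0 //.
by apply/eqP; rewrite eqEsubv fixedField_bound.
Qed.

Lemma galois_closure_mid (k : fieldType) (M : splittingFieldType k)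
    (L F E : {subfield M}) :
  galois_closure L E -> (L <= F <= E)%VS -> galois_closure F E.
Proof.
case=> sLE galE minE /andP[sLF sFE]; split=> // E' sFE'.
exact/minE/(subv_trans sLF).
Qed.

Lemma galois_closure_uniq (k : fieldType) (M : splittingFieldType k)
    (L E E' : {subfield M}) :
  galois_closure L E -> galois_closure L E' -> E = E'.
Proof.
move=> [sLE galE minE] [sLE' galE' minE'].
by apply/val_inj/eqP; rewrite eqEsubv minE ?minE'.
Qed.

Lemma gal_transl_on_base (k : fieldType) (M : splittingFieldType k)
    (L E : {subfield M}) (g : gal_of E) :
  gal_transl L g 'Gal(E / L)%g = ('Gal(E / L) :* g)%g.
Proof.
rewrite gal_translE ?gal_in1 //.
by apply/rcosetsP; exists 1%g; rewrite ?rcoset1 ?group1.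
Qed.

(* If g in Gal(E/F) is the square of some c outside Gal(E/F), an element of a *)
(* regular group of translations moving the base coset to the coset of c has  *)
(* a square which fixes the base coset; so this square is trivial, and g acts *)
(* trivially on all cosets.                                                   *)
Lemma almost_classical_core (k : fieldType) (M : splittingFieldType k)
    (F E : {subfield M}) (c : gal_of E) (N : {group {perm {set gal_of E}}}) :
    regular_on (gal_cosets F E) N -> N \subset gal_transl_image F E ->
    (forall g, g \in ('Gal(E / F) :* c)%g -> (g * g = c * c)%g) ->
    (c * c)%g \in 'Gal(E / F)%g ->
  forall x : gal_of E, (x * (c * c) * x^-1)%g \in 'Gal(E / F)%g.
Proof.
move=> [_ regN] sN sqr ccF x.
have cos (g : gal_of E) : ('Gal(E / F) :* g)%g \in gal_cosets F E.
  by apply/rcosetsP; exists g; rewrite ?gal_in1.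
have base : 'Gal(E / F)%g \in gal_cosets F E by rewrite -[X in X \in _]rcoset1.
have [n [[nN nbase] _]] := regN _ _ base (cos c).
have /imsetP[g _ defn] := subsetP sN _ nN.
have gc : g \in ('Gal(E / F) :* c)%g.
  by rewrite -nbase defn gal_transl_on_base rcoset_refl.
have n2 : (n * n)%g = 1%g.
  have [m [_ uniq_m]] := regN _ _ base base.
  rewrite -(uniq_m 1%g); last by rewrite group1 perm1.
  apply/esym/uniq_m; split; first exact: groupM.
  rewrite permM nbase defn gal_translE ?gal_in1 //.
  rewrite -(rcoset_eqP gc) -rcosetM sqr // rcoset_id //.
have : (n * n)%g ('Gal(E / F) :* x)%g = ('Gal(E / F) :* x)%g by rewrite n2 perm1.
rewrite permM defn !gal_translE ?gal_in1 -?rcosetM // -mulgA sqr // => xz.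
have := rcoset_refl 'Gal(E / F)%G (x * (c * c))%g.
by rewrite xz mem_rcoset -mulgA.
Qed.

(* Degree 5 with a Galois group of order 20 *)
Local Close Scope ring_scope.

Theorem proposition3p1 (k : fieldType) (M : splittingFieldType k)
    (K Kt F : {subfield M})
    (sepK : separable 1 K) (degK : \dim K = 5)
    (Kt_closure : galois_closure K Kt)
    (ordG : #|'Gal(Kt / 1)%g| = 20)
    (sKF : (K <= F)%VS) (neqKF : (K : {vspace M}) <> F)
    (sFKt : (F <= Kt)%VS) (neqFKt : (F : {vspace M}) <> Kt) :
  [/\ \dim F = 10,
      hopf_galois (subvs_of F),
      ~ almost_classically_galois F
    & exists S1 S2 : hopfGaloisStructure (subvs_of F), ~ hgs_iso S1 S2].
Proof.
have [sKKt galKt _] := Kt_closure.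
have galF : galois F Kt by apply: galoisS galKt; rewrite sub1v.
have galK : galois K Kt by apply: galoisS galKt; rewrite sub1v.
have dimKt : \dim Kt = 20 by rewrite -ordG -galois_dim // dimv1 divn1.
have cardC : #|'Gal(Kt / K)%g| = 4 by rewrite -galois_dim // dimKt degK.
have dimF : \dim F = 10.
  have dF : \dim F \in divisors 20.
    by rewrite -dvdn_divisors // -dimKt field_dimS.
  have dK : 5 %| \dim F by rewrite -degK field_dimS.
  have F5 : \dim F != 5.
    by apply/eqP => F5; apply/neqKF/eqP; rewrite eqEdim sKF F5 degK.
  have F20 : \dim F != 20.
    by apply/eqP => F20; apply/neqFKt/eqP; rewrite eqEdim sFKt F20 dimKt.
  by move: dF dK F5 F20; rewrite !inE; do ?[case/orP]; move/eqP=> ->.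
have cardA : #|'Gal(Kt / F)%g| = 2 by rewrite -galois_dim // dimKt dimF.
have sCG : 'Gal(Kt / K)%g \subset 'Gal(Kt / 1)%g by rewrite galS ?sub1v.
have sAC : 'Gal(Kt / F)%g \subset 'Gal(Kt / K)%g by rewrite galS.
have [P [nPG defG cycC centC]] :=
  order20_structure ordG cardC sCG (fun N => galois_closure_core Kt_closure).
have [sqrA sqr1 rootA] := cyclic_order4_sqr cardC sAC cardA cycC.
have closF : galois_closure F Kt.
  by apply: galois_closure_mid Kt_closure _; rewrite sKF.
have [z zA z1] : exists2 z, z \in 'Gal(Kt / F)%g & z != 1%g.
  by apply/trivgPn; rewrite trivg_card1 cardA.
have [c cC cz] := rootA z zA.
pose pi := remgr P 'Gal(Kt / K)%G.
have [_ defPC nPC tiPC] := sdprodP defG.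
have compl : 'Gal(Kt / K)%G \in [complements to P in 'Gal(Kt / 1)]%g.
  exact: sdprod_compl defG.
have memG (g : gal_of Kt) : g \in (P * 'Gal(Kt / K))%g by rewrite defPC gal_in1.
have piC g : pi g \in 'Gal(Kt / K)%g by rewrite mem_remgr.
have pi_id : {in 'Gal(Kt / K)%g, forall x, pi x = x}.
  by move=> x xC; apply: remgr_id.
have piM : {morph pi : x y / (x * y)%g}.
  by move=> x y; apply: (remgrM compl nPG); rewrite gal_in1.
have pi_comm x y : commute (pi x) (pi y).
  exact: (centsP (cyclic_abelian cycC)).
pose D := (P <*> 'Gal(Kt / F))%G.
have nPA : 'Gal(Kt / F)%g \subset 'N(P)%g := subset_trans sAC nPC.
have defD : D = (P * 'Gal(Kt / F))%g :> {set _} by rewrite /= norm_joinEr.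
have memD x : (x \in D) = (pi x \in 'Gal(Kt / F)%g).
  rewrite defD; apply/mulsgP/idP => [[p a pP aA ->]|xA].
    by rewrite /pi remgrMl // [remgr _ _ _]pi_id // (subsetP sAC).
  exists (divgr P 'Gal(Kt / K)%G x) (pi x); rewrite ?mem_divgr //.
  exact: divgr_eq.
have cardD : #|D| = \dim F.
  rewrite defD TI_cardMg; last by apply/trivgP; rewrite -tiPC setIS.
  have : (#|P| * 4)%N = (5 * 4)%N.
    by rewrite -cardC -(TI_cardMg tiPC) defPC ordG cardC.
  by move/eqP; rewrite eqn_pmul2r // cardA dimF => /eqP ->.
have zC : z \in 'Gal(Kt / K)%g := subsetP sAC z zA.
(* As C acts faithfully on P, the involution [z] does not centralize P; [p] will distinguish the two
   structures. *)
have [p pP /eqP zp] : exists2 p, p \in P & (z ^ p)%g != z.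
  apply/exists_inP; apply: contraR z1 => /exists_inPn zP.
  have : z \in ('Gal(Kt / K) :&: 'C(P))%g.
    rewrite inE zC; apply/centP => p pP.
    by apply/commgP/conjg_fixP; have := zP p pP; rewrite negbK => /eqP.
  by rewrite centC inE.
have str : exists S1 S2 : hopfGaloisStructure (subvs_of F), ~ hgs_iso S1 S2.
  have pi_idem x : pi (pi x) = pi x by rewrite pi_id.
  have pi_galF : {in 'Gal(Kt / F)%g, forall x, pi x = x}.
    by move=> x /(subsetP sAC)/pi_id.
  have pi_sqr x : (pi x * pi x)%g \in 'Gal(Kt / F)%g by apply: sqrA.
  have pi_sqr1 x : (pi x * pi x)%g = 1%g <-> pi x \in 'Gal(Kt / F)%g.
    by apply: sqr1.
  have pi_root x : x \in 'Gal(Kt / F)%g -> exists2 y, pi y = y & (y * y)%g = x.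
    by case/rootA=> y /pi_id piy yy; exists y.
  have /fin_all_exists[sec secK] :=
    sqr_cocycle_surj piM pi_idem pi_galF pi_sqr pi_root memD.
  apply: (two_hopf_galois_structures piM pi_comm pi_idem pi_galF pi_sqr pi_sqr1
    memD secK galKt sFKt cardD _ _ zp); last exact: remgr1.
  by rewrite memD pi_galF.
split=> //; first by have [S _] := str; exists S.
case=> E' [closE' [N [regN _ sN]]].
have eqE := galois_closure_uniq closF closE'; subst E'.
(* C is abelian and the elements of Gal(Kt/F) square to 1, so the whole coset of [c] has the same
   square. *)
have sqr_c g : g \in ('Gal(Kt / F) :* c)%g -> (g * g = c * c)%g.
  case/rcosetP=> a aA ->; have aC := subsetP sAC a aA.
  have ac : commute a c := centsP (cyclic_abelian cycC) a aC c cC.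
  rewrite -[LHS]/((a * c) ^+ 2)%g expgMn // -[(a ^+ 2)%g]/(a * a)%g.
  by rewrite (sqr1 a aC).2 ?mul1g.
have := almost_classical_core regN sN sqr_c; rewrite cz => /(_ zA) zcore.
have defA : 'Gal(Kt / F)%g = <[z]>%g.
  apply/esym/eqP; rewrite eqEcard cycle_subG zA cardA.
  by rewrite ltnNge -trivg_card_le1 cycle_eq1.
(* Every conjugate of the generator [z] lies in Gal(Kt/F) by [zcore]. *)
have nA : ('Gal(Kt / F) <| 'Gal(Kt / 1))%g.
  rewrite /normal (subset_trans sAC) //=; apply/subsetP => x _.
  rewrite inE {1}defA -cycleJ cycle_subG.
  by have := zcore x^-1%g; rewrite invgK conjgE -mulgA.
have := galois_closure_core closF nA (subxx _).
by move/eqP; rewrite trivg_card1 cardA.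
Qed.
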